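(* Let $\mathcal{P}$ be a model dominated by $\nu$, $P_0\in\mathcal{P}$, and let $\beta:\mathcal{P}\to\mathbb{R}$, $\eta:\mathcal{P}\to\mathcal{H}\subset\mathcal{V}$ be functionals with $\beta_0=\beta(P_0)$, $\eta_0=\eta(P_0)$. Let $m:\mathcal{Z}\times\mathbb{R}\times\mathcal{H}\to\mathbb{R}$ be an estimating function (measurable in $z$ for each $(\beta,\eta)$). Assume: (1) (Correct specification) $\mathbb{E}_P[m(Z;\beta(P),\eta(P))]=0$ for all $P\in\mathcal{P}$ with $(\beta(P),\eta(P))$ in some neighborhood of $(\beta_0,\eta_0)$. (2) (Fréchet differentiability) There are bounded linear maps $D_\beta m_0:\mathbb{R}\to L_2(P_0)$ and $D_\eta m_0:\mathcal{V}\to L_2(P_0)$ with $$\|m(\cdot;\beta,\eta)-m(\cdot;\beta_0,\eta_0)-D_\beta m_0(\beta-\beta_0)-D_\eta m_0(\eta-\eta_0)\|_{L_2(P_0)}=o(|\beta-\beta_0|+\|\eta-\eta_0\|_{\mathcal{V}}).$$ Write $\partial_\beta m(Z;\beta_0,\eta_0):=D_\beta m_0(1)(Z)$. (3) (Influence function representation) $\beta$ is pathwise differentiable at $P_0$ with influence function $\varphi(Z)\equiv m(Z;\beta_0,\eta_0)$. (4) (Local product structure) (a) There is a regular submodel $t\mapsto P_t$ through $P_0$ (the $\beta$-coordinate submodel, with score denoted $s_\beta$) along which $\beta(P_t)$ and $\eta(P_t)$ are differentiable at $t=0$ with $\frac{d}{dt}\beta(P_t)|_{t=0}=1$ and $\frac{d}{dt}\eta(P_t)|_{t=0}=0$.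 (b) For every $h\in\dot{\mathcal{H}}$ there is a regular submodel $t\mapsto P_t$ through $P_0$ (the $\eta$-coordinate submodel in direction $h$, with score denoted $s_h$) along which $\beta(P_t)$ and $\eta(P_t)$ are differentiable at $t=0$ with $\frac{d}{dt}\beta(P_t)|_{t=0}=0$ and $\frac{d}{dt}\eta(P_t)|_{t=0}=h$. (5) (Regularity along coordinate submodels) For each coordinate submodel $t\mapsto P_{t,s}$ in (4), the score $s$ is bounded and the functions $f_{t,s}(Z):=m(Z;\beta(P_{t,s}),\eta(P_{t,s}))$ are measurable, $f_0:=m(\cdot;\beta_0,\eta_0)$ is bounded, there is $\dot f_0\in L_2(P_0)$ with $\mathbb{E}_0[((f_{t,s}-f_0)/t-\dot f_0)^2]\to0$ as $t\to0$, and there are $\delta>0$, $C<\infty$ with $\sup_{0<|t|<\delta}\mathbb{E}_{P_{t,s}}[((f_{t,s}-f_0)/t)^2]\le C$. Then: (i) (Neyman orthogonality) For all $h\in\dot{\mathcal{H}}$, $\frac{\partial}{\partial\eta}\mathbb{E}_0[m(Z;\beta_0,\eta)]\big|_{\eta=\eta_0}[h]=0$. (ii) ($-1$ normalization) $G:=\mathbb{E}_0[\partial_\beta m(Z;\beta_0,\eta_0)]=-1$.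
   Context: $(\mathcal{Z},\mathcal{A})$ is a measurable space, $\nu$ a $\sigma$-finite measure on it, and $\mathcal{P}$ (the model) is a set of probability measures all dominated by $\nu$; densities are $p=dP/d\nu$; $P_0\in\mathcal{P}$ is fixed with density $p_0$ and $\mathbb{E}_0=\mathbb{E}_{P_0}$. $L_2^0(P_0)=\{f\in L_2(P_0):\mathbb{E}_0[f]=0\}$. A regular (QMD) submodel through $P_0$ is a family $\{P_t:t\in(-\epsilon,\epsilon)\}\subset\mathcal{P}$ with $P_{t=0}=P_0$ and densities $p_t$ such that for some $s\in L_2^0(P_0)$ (its score), $\int\big(\frac{\sqrt{p_t}-\sqrt{p_0}}{t}-\frac12 s\sqrt{p_0}\big)^2d\nu\to0$ as $t\to0$. $\mathcal{V}$ is a normed vector space with norm $\|\cdot\|_{\mathcal{V}}$, $\mathcal{H}\subset\mathcal{V}$; derivatives of $\eta(P_t)$ are taken in $\mathcal{V}$-norm. The set of admissible perturbation directions is $\dot{\mathcal{H}}=\{h\in\mathcal{V}:\exists\epsilon>0,\ \eta_0+th\in\mathcal{H}\ \text{for all}\ |t|<\epsilon\}$. The Gâteaux derivative $\frac{\partial}{\partial\eta}\mathbb{E}_0[m(Z;\beta_0,\eta)]|_{\eta=\eta_0}[h]$ is $\frac{d}{dt}\mathbb{E}_0[m(Z;\beta_0,\eta_0+th)]|_{t=0}$. $\beta$ is pathwise differentiable at $P_0$ with influence function $\varphi\in L_2^0(P_0)$ if for every regular submodel $t\mapsto P_{t,s}$ through $P_0$ with score $s$, $\frac{d}{dt}\beta(P_{t,s})|_{t=0}$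 exists and equals $\mathbb{E}_0[\varphi(Z)s(Z)]$. *)

(* Defs.v *)
From HB Require Import structures.
From mathcomp Require Import all_boot all_order all_algebra.
From mathcomp Require Import all_classical all_reals all_analysis.

Set Implicit Arguments.
Unset Strict Implicit.
Unset Printing Implicit Defensive.

Import Order.TTheory GRing.Theory Num.Theory.
Import numFieldNormedType.Exports.

Local Open Scope classical_set_scope.
Local Open Scope ring_scope.

(* MathComp-Analysis, with an abstract realType.

   Partial objects are total functions here: functionals on the model are
   defined on all of [probability Z R], an estimating function on all of V, and
   a submodel on all of R. Every condition is restricted to the true domain
   (the model, H, and |t| < eps), so the values elsewhere play no role.

   Elements of L_2(P) are represented by functions, identified only up to
   P-a.e. equality. *)

Section submodels.
Context (R : realType) (d : measure_display) (Z : measurableType d).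
Implicit Types (P : probability Z R) (s phi : Z -> R)
  (Pt : R -> probability Z R).

Definition density (nu : {sigma_finite_measure set Z -> \bar R}) P : Z -> R :=
  fine \o Radon_Nikodym_SigmaFinite.f P nu.

Definition L20 P0 : set (Z -> R) :=
  [set f | f \in Lfun P0 2%:E /\ ('E_P0[f] = 0)%E].

Definition qmd_at (nu : {sigma_finite_measure set Z -> \bar R}) Pt s : Prop :=
  (\int[nu]_z
     (((Num.sqrt (density nu (Pt t) z) - Num.sqrt (density nu (Pt 0) z)) / t
       - 2^-1 * s z * Num.sqrt (density nu (Pt 0) z)) ^+ 2)%:E)%E
    @[t --> (0 : R)^'] --> 0%E.

Definition regular_submodel (nu : {sigma_finite_measure set Z -> \bar R})
    (model : set (probability Z R)) P0 (eps : R) Pt s : Prop :=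
  [/\ 0 < eps,
      forall t : R, `|t| < eps -> model (Pt t),
      Pt 0 = P0,
      L20 P0 s
    & qmd_at nu Pt s].

(* The integral defining the derivative is finite because phi and s are in
   L_2(P0). *)
Definition pathwise_differentiable
    (nu : {sigma_finite_measure set Z -> \bar R})
    (model : set (probability Z R)) (beta : probability Z R -> R) P0 phi
    : Prop :=
  L20 P0 phi /\
  forall (eps : R) Pt s, regular_submodel nu model P0 eps Pt s ->
    is_derive (0 : R) 1 (beta \o Pt) (\int[P0]_z (phi z * s z)).

End submodels.

Section estimating_functions.
Context (R : realType) (d : measure_display) (Z : measurableType d).
Context (V : normedModType R).
Implicit Types (P : probability Z R) (s : Z -> R)
  (Pt : R -> probability Z R) (beta : probability Z R -> R)
  (eta : probability Z R -> V) (m : Z -> R -> V -> R) (H : set V).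

Definition admissible_directions H (eta0 : V) : set V :=
  [set h | exists2 eps : R, 0 < eps &
           forall t : R, `|t| < eps -> H (eta0 + t *: h)].

(* An extended-real integral equal to 0 is that of an integrable function,
   since (+oo) - (+oo) = -oo in \bar R. *)
Definition correctly_specified (model : set (probability Z R)) beta eta m P0
    : Prop :=
  exists2 U : set (R * V), nbhs (beta P0, eta P0) U &
    forall P, model P -> U (beta P, eta P) ->
      ('E_P[(fun z => m z (beta P) (eta P))] = 0)%E.

Definition bounded_linear_L2 P0 (W : normedModType R) (D : W -> Z -> R)
    : Prop :=
  [/\ forall w, D w \in Lfun P0 2%:E,
      forall (a : R) (u v : W),
        D (a *: u + v) = (fun z => a * D u z + D v z) %[ae P0]
    & exists C : R, forall w, ('N[P0]_2%:E[EFin \o D w] <= (C * `|w|)%:E)%E].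

Definition frechet_derivative_L2 P0 H m (beta0 : R) (eta0 : V)
    (Dbeta : R -> Z -> R) (Deta : V -> Z -> R) : Prop :=
  forall e : R, 0 < e ->
    \forall x \near (beta0, eta0), H x.2 ->
      ('N[P0]_2%:E[(fun z => (m z x.1 x.2 - m z beta0 eta0
                    - Dbeta (x.1 - beta0) z - Deta (x.2 - eta0) z)%:E)]
        <= (e * (`|x.1 - beta0| + `|x.2 - eta0|))%:E)%E.

Definition coordinate_submodel (nu : {sigma_finite_measure set Z -> \bar R})
    (model : set (probability Z R)) beta eta P0 (eps : R) Pt s
    (dbeta : R) (deta : V) : Prop :=
  [/\ regular_submodel nu model P0 eps Pt s,
      is_derive (0 : R) 1 (beta \o Pt) dbeta
    & is_derive (0 : R) 1 (eta \o Pt) deta].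

Definition regular_along beta eta m P0 (eps : R) Pt s : Prop :=
  let f0 z := m z (beta P0) (eta P0) in
  let f t z := m z (beta (Pt t)) (eta (Pt t)) in
  [/\ bounded_fun s,
      forall t : R, `|t| < eps -> measurable_fun setT (f t),
      bounded_fun f0,
      exists2 df0 : Z -> R, df0 \in Lfun P0 2%:E &
        ('E_P0[(fun z => ((f t z - f0 z) / t - df0 z) ^+ 2)%R])%E
          @[t --> (0 : R)^'] --> 0%E
    & exists delta C : R, 0 < delta <= eps /\
        forall t : R, 0 < `|t| < delta ->
          ('E_(Pt t)[(fun z => ((f t z - f0 z) / t) ^+ 2)%R] <= C%:E)%E].

(* [Rintegral] is a junk value for a non-integrable function, so integrability
   near t = 0 is part of the definition. *)
Definition is_gateaux_derivative P0 (g : Z -> V -> R) (eta0 h : V) (l : R)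
    : Prop :=
  (\forall t \near (0 : R),
     P0.-integrable setT (fun z => (g z (eta0 + t *: h))%:E)) /\
  is_derive (0 : R) 1 (fun t : R => \int[P0]_z g z (eta0 + t *: h)) l.

End estimating_functions.

(* Main.v *)
(* Fix a coordinate submodel P_t with score s, along which (beta, eta) has
   derivative (b', h), and put f_t := m(.; beta(P_t), eta(P_t)),
   g_t := (f_t - f_0) / t, D := Dbeta b' + Deta h. Dividing
   E_{P_t}[f_t] - E_0[f_0] = 0 by t and letting t tend to 0 gives
     E_0[D] + E_0[f_0 s] = 0.
   Indeed g_t tends to D in L_2(P_0) by Frechet differentiability, and quadratic
   mean differentiability turns the change of measure into the score, since
   p_t - p_0 = (sqrt p_t - sqrt p_0) (sqrt p_t + sqrt p_0). As f_0 is the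
   influence function, E_0[f_0 s] = b', so E_0[D] = - b'. The beta-coordinate
   (b' = 1, h = 0) gives the normalization, and the eta-coordinate (b' = 0)
   gives E_0[Deta h] = 0, which is the Gateaux derivative. *)

Require Import Defs.
From HB Require Import structures.
From mathcomp Require Import all_boot all_order all_algebra.
From mathcomp Require Import all_classical all_reals all_analysis.
From mathcomp Require Import measurable_realfun ring lra.
Import Order.TTheory GRing.Theory Num.Theory.
Import numFieldNormedType.Exports.
Local Open Scope classical_set_scope.
Local Open Scope ring_scope.

Set Implicit Arguments.
Unset Strict Implicit.
Unset Printing Implicit Defensive.

(** * First and second absolute moments with explicit real bounds *)

Section square_integrals.
Context {d : measure_display} {Z : measurableType d} {R : realType}.
Implicit Types (mu : {measure set Z -> \bar R}) (f g : Z -> R) (a b c : R).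

(** Measurability travels with a real bound, so integrability is automatic and estimates become real
    arithmetic on the bounds. In [L2le] the bound is on the squared norm. *)
Definition L1le mu a f :=
  measurable_fun setT f /\ (\int[mu]_z (`|f z|)%:E <= a%:E)%E.

Definition L2le mu a f :=
  measurable_fun setT f /\ (\int[mu]_z (f z ^+ 2)%:E <= a%:E)%E.

(** Reduces each moment bound below to a pointwise inequality between nonnegative functions. *)
Lemma ge0_integral_comb_le mu (k l a b : R) (u v w : Z -> R) :
  0 <= k -> 0 <= l ->
  measurable_fun setT u -> measurable_fun setT v -> measurable_fun setT w ->
  (forall z, 0 <= u z) -> (forall z, 0 <= v z) -> (forall z, 0 <= w z) ->
  (forall z, u z <= k * v z + l * w z) ->
  (\int[mu]_z (v z)%:E <= a%:E)%E -> (\int[mu]_z (w z)%:E <= b%:E)%E ->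
  (\int[mu]_z (u z)%:E <= (k * a + l * b)%:E)%E.
Proof.
move=> k0 l0 mu_ mv mw u0 v0 w0 uvw va wb.
apply: (@le_trans _ _ (\int[mu]_z (k%:E * (v z)%:E + l%:E * (w z)%:E))%E).
  apply: ge0_le_integral => //.
  - by move=> z _; rewrite lee_fin.
  - exact/measurable_EFinP.
  - apply/measurable_EFinP.
    by apply: measurable_funD; apply: measurable_funM.
  - by move=> z _; rewrite -!EFinM -EFinD lee_fin.
rewrite ge0_integralD//; last 4 first.
- by move=> z _; rewrite -EFinM lee_fin mulr_ge0.
- by apply/measurable_EFinP; apply: measurable_funM.
- by move=> z _; rewrite -EFinM lee_fin mulr_ge0.
- by apply/measurable_EFinP; apply: measurable_funM.
rewrite !ge0_integralZl//; do ?exact/measurable_EFinP.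
  by rewrite EFinD !EFinM leeD// lee_wpmul2l// lee_fin.
all: by move=> z _; rewrite lee_fin.
Qed.

Lemma L2leW mu a b f : a <= b -> L2le mu a f -> L2le mu b f.
Proof. by move=> ab [mf fa]; split=> //; rewrite (le_trans fa)// lee_fin. Qed.

Lemma L1leW mu a b f : a <= b -> L1le mu a f -> L1le mu b f.
Proof. by move=> ab [mf fa]; split=> //; rewrite (le_trans fa)// lee_fin. Qed.

(** The constants come from [(f + g)^2 <= 2 f^2 + 2 g^2], that is, from [(f - g)^2 >= 0]. *)
Lemma L2leD mu a b f g : L2le mu a f -> L2le mu b g ->
  L2le mu (2 * a + 2 * b) (f \+ g).
Proof.
move=> [mf fa] [mg gb]; split; first exact: measurable_funD.
apply: ge0_integral_comb_le fa gb => //; do ?exact: measurable_funX;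
  do ?by move=> z; rewrite sqr_ge0.
  by apply: measurable_funX; exact: measurable_funD.
by move=> z /=; have := sqr_ge0 (f z - g z); nra.
Qed.

Lemma L1leD mu a b f g : L1le mu a f -> L1le mu b g ->
  L1le mu (a + b) (f \+ g).
Proof.
move=> [mf fa] [mg gb]; split; first exact: measurable_funD.
rewrite -[a]mul1r -[b]mul1r.
apply: ge0_integral_comb_le fa gb => //; do ?exact: measurableT_comp.
  by apply: measurableT_comp => //; exact: measurable_funD.
by move=> z /=; rewrite !mul1r ler_normD.
Qed.

Lemma L2le_mul_bounded mu (M a : R) f g : measurable_fun setT f ->
  (forall z, `|f z| <= M) -> L2le mu a g -> L2le mu (M ^+ 2 * a) (f \* g).
Proof.
move=> mf fM [mg ga]; split; first exact: measurable_funM.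
rewrite -[M ^+ 2 * a]addr0 -[in leRHS](mul0r a).
apply: (ge0_integral_comb_le _ _ _ _ _ _ _ _ _ ga ga) => //;
  do ?exact: measurable_funX;
  do ?by move=> z; rewrite sqr_ge0.
  by rewrite sqr_ge0.
  by apply: measurable_funX; exact: measurable_funM.
move=> z /=; rewrite exprMn mul0r addr0 ler_wpM2r ?sqr_ge0//.
by rewrite -real_normK ?num_real// lerXn2r ?nnegrE// (le_trans _ (fM z)).
Qed.

Lemma L2leZ mu (k a : R) f : L2le mu a f -> L2le mu (k ^+ 2 * a) (k \*o f).
Proof.
by move=> fa; rewrite -[k ^+ 2]real_normK ?num_real//;
  exact: (@L2le_mul_bounded _ _ _ (cst k)).
Qed.

(** Weighted Young inequality, in place of Cauchy-Schwarz: expand [c^-1 (c |f| - |g|)^2 >= 0]. The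
    free weight [c] is tuned later to make a small factor times a bounded one small. *)
Lemma L1leM mu c a b f g : 0 < c -> L2le mu a f -> L2le mu b g ->
  L1le mu (c * a + c^-1 * b) (f \* g).
Proof.
move=> c0 [mf fa] [mg gb]; split; first exact: measurable_funM.
apply: ge0_integral_comb_le fa gb => //; do ?exact: measurable_funX;
  do ?by move=> z; rewrite sqr_ge0.
  exact: ltW.
  by rewrite invr_ge0 ltW.
  by apply: measurableT_comp => //; exact: measurable_funM.
move=> z /=; rewrite normrM -(real_normK (num_real (f z))).
rewrite -(real_normK (num_real (g z))).
have : 0 <= c^-1 * (c * `|f z| - `|g z|) ^+ 2.
  by rewrite mulr_ge0 ?sqr_ge0// invr_ge0 ltW.
have -> : c^-1 * (c * `|f z| - `|g z|) ^+ 2 =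
    c * `|f z| ^+ 2 + c^-1 * `|g z| ^+ 2 - 2 * (`|f z| * `|g z|).
  by field; rewrite gt_eqF.
have : 0 <= `|f z| * `|g z| by rewrite mulr_ge0.
lra.
Qed.

Lemma L1le_integrable mu a f : L1le mu a f -> mu.-integrable setT (EFin \o f).
Proof.
move=> [mf fa]; apply/integrableP; split; first exact/measurable_EFinP.
by rewrite (le_lt_trans _ (ltry a)).
Qed.

Lemma L1le_Rintegral mu a f : L1le mu a f -> `|\int[mu]_z f z| <= a.
Proof.
move=> fa; rewrite -lee_fin EFin_normr_Rintegral//;
  last exact: L1le_integrable fa.
case: fa => mf fa; apply: le_trans fa.
by apply: le_abse_integral => //; exact/measurable_EFinP.
Qed.

Lemma Lfun2_L2le mu f : f \in Lfun mu 2%:E -> exists a, L2le mu a f.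
Proof.
move=> f2; have /integrableP[_ fi] := Lfun2_integrable_sqr f2.
move: f2; rewrite inE => /andP[+ _]; rewrite inE/= => mf.
exists (fine (\int[mu]_z (f z ^+ 2)%:E)); split=> //.
rewrite fineK// ge0_fin_numE ?integral_ge0//; last first.
  by move=> z _; rewrite lee_fin sqr_ge0.
rewrite (le_lt_trans _ fi)// le_eqVlt; apply/orP; left; apply/eqP.
by apply: eq_integral => z _ /=; rewrite ger0_norm// sqr_ge0.
Qed.

Lemma Lnorm2_le mu a f : measurable_fun setT f ->
  ('N[mu]_2%:E[EFin \o f] <= a%:E)%E -> L2le mu (a ^+ 2) f.
Proof.
move=> mf fa; split=> //.
(* The norm is nonnegative, hence so is its bound; this makes squaring monotone here. *)
have a0 : 0 <= a by rewrite -lee_fin (le_trans _ fa)// Lnorm_ge0.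
have -> : (\int[mu]_z (f z ^+ 2)%:E = 'N[mu]_2%:E[EFin \o f] `^ 2)%E.
  rewrite poweR_Lnorm//; apply: eq_integral => z _ /=.
  by rewrite powR_mulrn// real_normK ?num_real.
rewrite -powR_mulrn// -poweR_EFin gt0_ler_poweR// in_itv /= leey andbT
  ?Lnorm_ge0//.
Qed.

Lemma ae_eq_L2le mu a f g : measurable_fun setT f ->
  f = g %[ae mu] -> L2le mu a g -> L2le mu a f.
Proof.
move=> mf fg [mg ga]; split=> //; apply: le_trans ga.
rewrite (@ge0_ae_eq_integral _ _ _ mu setT _ (fun z => (g z ^+ 2)%:E))//.
- exact/measurable_EFinP/measurable_funX.
- exact/measurable_EFinP/measurable_funX.
- by move=> z _; rewrite lee_fin sqr_ge0.
- by move=> z _; rewrite lee_fin sqr_ge0.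
- by apply: filterS fg => z fgz _; rewrite fgz.
Qed.

Lemma L2le_cst1 (P : probability Z R) : L2le P 1 (cst 1).
Proof.
split=> //; under eq_integral do rewrite expr1n.
by rewrite integral_cst// mul1e; exact: probability_le1.
Qed.

Lemma L2le_integrable (P : probability Z R) a f :
  L2le P a f -> P.-integrable setT (EFin \o f).
Proof.
move=> fa; have := L1le_integrable (L1leM ltr01 fa (L2le_cst1 P)).
by apply: eq_integrable => // z _ /=; rewrite mulr1.
Qed.

End square_integrals.

(** * Change of measure from [P] to [nu] through the density *)

Section densities.
Context {d : measure_display} {Z : measurableType d} {R : realType}.
Variables (nu : {sigma_finite_measure set Z -> \bar R}) (P : probability Z R).
Hypothesis Pnu : P `<< nu.
Implicit Types (f : Z -> R) (a : R).

Lemma density_ge0 z : 0 <= density nu P z.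
Proof. exact/fine_ge0/Radon_Nikodym_SigmaFinite.f_ge0. Qed.

Lemma measurable_density : measurable_fun setT (density nu P).
Proof.
apply: measurableT_comp => //.
exact: measurable_int (Radon_Nikodym_SigmaFinite.f_integrable Pnu).
Qed.

Lemma measurable_sqrt_density :
  measurable_fun setT (fun z => Num.sqrt (density nu P z)).
Proof.
have /measurableT_comp : measurable_fun setT (@Num.sqrt R).
  by apply: continuous_measurable_fun; exact: sqrt_continuous.
by apply; exact: measurable_density. Qed.

Lemma ge0_integral_density f : (forall z, 0 <= f z) ->
  measurable_fun setT f ->
  (\int[P]_z (f z)%:E = \int[nu]_z (f z * density nu P z)%:E)%E.
Proof.
move=> f0 mf; rewrite -(Radon_Nikodym_SigmaFinite.change_of_variables Pnu)//.
- apply: eq_integral => z _; rewrite EFinM /density /= fineK//.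
  exact: Radon_Nikodym_SigmaFinite.f_fin_num.
- exact/measurable_EFinP.
Qed.

(** The density is nonnegative, so it commutes with taking positive and negative parts; no
    integrability is required. *)
Lemma integral_density f : measurable_fun setT f ->
  (\int[P]_z (f z)%:E = \int[nu]_z (f z * density nu P z)%:E)%E.
Proof.
move=> mf; rewrite integralE [RHS]integralE; congr (_ - _)%E.
- under eq_integral do rewrite funeposE -EFin_max.
  rewrite ge0_integral_density//; last 2 first.
    by move=> z; rewrite le_max lexx orbT.
    exact: measurable_maxr.
  apply: eq_integral => z _; rewrite funeposE -EFin_max.
  by rewrite maxr_pMl ?density_ge0// mul0r.
- under eq_integral do rewrite funenegE -EFin_max.
  rewrite ge0_integral_density//; last 2 first.
    by move=> z; rewrite le_max lexx orbT.
    by apply: measurable_maxr => //; exact: measurableT_comp.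
  apply: eq_integral => z _; rewrite funenegE -EFin_max.
  by rewrite maxr_pMl ?density_ge0// mul0r mulNr.
Qed.

Lemma Rintegral_density f : measurable_fun setT f ->
  \int[P]_z f z = \int[nu]_z (f z * density nu P z).
Proof. by move=> mf; rewrite /Rintegral integral_density. Qed.

Lemma integrable_density f : P.-integrable setT (EFin \o f) ->
  nu.-integrable setT (fun z => (f z * density nu P z)%:E).
Proof.
move=> /integrableP[/measurable_EFinP mf fi]; apply/integrableP; split.
  by apply/measurable_EFinP; apply: measurable_funM => //;
    exact: measurable_density.
apply: le_lt_trans fi.
rewrite (ge0_integral_density (f := fun z => `|f z|))//; last first.
  exact: measurableT_comp.
rewrite le_eqVlt; apply/orP; left; apply/eqP; apply: eq_integral => z _ /=.
by rewrite normrM (ger0_norm (density_ge0 z)).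
Qed.

(** Multiplication by the root density is the isometric embedding of L_2(P) into L_2(nu). It places
    functions that live under different measures in one space. *)
Lemma L2le_density a f : L2le P a f ->
  L2le nu a (fun z => f z * Num.sqrt (density nu P z)).
Proof.
move=> [mf fa]; split.
  by apply: measurable_funM => //; exact: measurable_sqrt_density.
rewrite (le_trans _ fa)//.
rewrite (ge0_integral_density (f := fun z => f z ^+ 2)); last 2 first.
- by move=> z; rewrite sqr_ge0.
- exact: measurable_funX.
rewrite le_eqVlt; apply/orP; left; apply/eqP; apply: eq_integral => z _ /=.
by rewrite exprMn sqr_sqrtr// density_ge0.
Qed.

Lemma L2le_sqrt_density : L2le nu 1 (fun z => Num.sqrt (density nu P z)).
Proof.
move: (L2le_cst1 P) => /L2le_density; congr L2le; apply/funext => z.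
exact: mul1r.
Qed.

End densities.

(** * Families that vanish or stay bounded in L_1 and L_2 along a filter *)

Section vanishing.
Context {d : measure_display} {Z : measurableType d} {R : realType}.
Context {T : Type} (F : set_system T) {FF : Filter F}.
Variable mu : {measure set Z -> \bar R}.
Implicit Types (u v : T -> Z -> R) (f : Z -> R).

Definition L1_to0 u := forall e, 0 < e -> \forall t \near F, L1le mu e (u t).

Definition L2_to0 u := forall e, 0 < e -> \forall t \near F, L2le mu e (u t).

Definition L2_bounded u := exists a, \forall t \near F, L2le mu a (u t).

Lemma L2_to0_bounded u : L2_to0 u -> L2_bounded u.
Proof. by move=> u0; exists 1; exact: u0. Qed.

Lemma L2_bounded_cst f a : L2le mu a f -> L2_bounded (fun=> f).
Proof. by move=> fa; exists a; exact: nearW. Qed.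

Lemma eq_L2_to0 u v : (forall t z, u t z = v t z) -> L2_to0 u -> L2_to0 v.
Proof. by move=> uv; congr L2_to0; apply/funext => t; apply/funext. Qed.

Lemma eq_L2_bounded u v : (forall t z, u t z = v t z) ->
  L2_bounded u -> L2_bounded v.
Proof. by move=> uv; congr L2_bounded; apply/funext => t; apply/funext. Qed.

Lemma L2_boundedD u v :
  L2_bounded u -> L2_bounded v -> L2_bounded (fun t => u t \+ v t).
Proof.
move=> [a ua] [b vb]; exists (2 * a + 2 * b).
by apply: filterS2 ua vb => t; exact: L2leD.
Qed.

Lemma L2_to0D u v : L2_to0 u -> L2_to0 v -> L2_to0 (fun t => u t \+ v t).
Proof.
move=> u0 v0 e e0; have e4 : 0 < e / 4 by rewrite divr_gt0.
apply: filterS2 (u0 _ e4) (v0 _ e4) => t /L2leD /[apply]; apply: L2leW.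
by lra.
Qed.

Lemma L1_to0D u v : L1_to0 u -> L1_to0 v -> L1_to0 (fun t => u t \+ v t).
Proof.
move=> u0 v0 e e0; have e2 : 0 < e / 2 by rewrite divr_gt0.
apply: filterS2 (u0 _ e2) (v0 _ e2) => t /L1leD /[apply]; apply: L1leW.
by lra.
Qed.

Lemma L2_to0_mul_bounded u f M : measurable_fun setT f ->
  (forall z, `|f z| <= M) -> L2_to0 u -> L2_to0 (fun t => f \* u t).
Proof.
(* Adding 1 keeps the divisor positive when [M] is 0. *)
move=> mf fM u0 e e0; have M0 : 0 < M ^+ 2 + 1 by rewrite ltr_wpDl ?sqr_ge0.
apply: filterS (u0 _ (divr_gt0 e0 M0)) => t /(L2le_mul_bounded mf fM).
apply: L2leW; rewrite mulrCA ler_piMr//; first exact: ltW.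
rewrite ler_pdivrMr// mul1r.
by rewrite lerDl.
Qed.

(** The weight [c] makes the bounded factor contribute at most [e / 2]; the vanishing factor is then
    taken below [e / (2 * c)], so that it contributes [e / 2] as well. *)
Lemma L2_to0M u v :
  L2_to0 u -> L2_bounded v -> L1_to0 (fun t => u t \* v t).
Proof.
move=> u0 [b vb] e e0; pose c := 2 * (`|b| + 1) / e.
have c0 : 0 < c by rewrite divr_gt0// mulr_gt0// ltr_wpDl.
have ec : 0 < e / (2 * c) by rewrite divr_gt0// mulr_gt0.
apply: filterS2 (u0 _ ec) vb => t ut /(L1leM c0 ut); apply: L1leW.
have -> : c * (e / (2 * c)) = e / 2 by field; rewrite gt_eqF.
suff : c^-1 * b <= e / 2 by lra.
rewrite mulrC ler_pdivrMr// /c; have := ler_norm b.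
have -> : e / 2 * (2 * (`|b| + 1) / e) = `|b| + 1 by field; rewrite gt_eqF.
by lra.
Qed.

Lemma L2_to0P u : (\forall t \near F, measurable_fun setT (u t)) ->
  (\int[mu]_z (u t z ^+ 2)%:E)%E @[t --> F] --> 0%E -> L2_to0 u.
Proof.
move=> mu_ u0 e e0.
move/fine_cvgP : u0 => [ufin /cvgr_lt/(_ _ e0) ue].
apply: filterS3 mu_ ufin ue => t mut utfin ute; split=> //.
by rewrite -(fineK utfin) lee_fin ltW.
Qed.

End vanishing.

(** * Differentiating a moment along a QMD path *)

Section score_identity.
Context {d : measure_display} {Z : measurableType d} {R : realType}.
Variables (nu : {sigma_finite_measure set Z -> \bar R}).
Variables (Pt : R -> probability Z R) (s : Z -> R).
Hypothesis Pt0_dominated : Pt 0 `<< nu.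
Hypothesis Pt_dominated : \forall t \near (0 : R)^', Pt t `<< nu.
Hypothesis s_L2 : s \in Lfun (Pt 0) 2%:E.
Hypothesis qmd : qmd_at nu Pt s.

Local Notation "'rp' t" := (fun z => Num.sqrt (density nu (Pt t) z))
  (at level 10, t at level 9).

Lemma qmd_L2_to0 : L2_to0 (0 : R)^' nu (fun t z =>
  (rp t z - rp 0 z) / t - 2^-1 * s z * rp 0 z).
Proof.
apply: L2_to0P qmd; apply: filterS Pt_dominated => t Ptnu.
have ms : measurable_fun setT s.
  by move: s_L2; rewrite inE => /andP[+ _]; rewrite inE.
have m0 := measurable_sqrt_density Pt0_dominated.
have mt := measurable_sqrt_density Ptnu.
apply: measurable_funB; last first.
  by apply: measurable_funM => //; exact: measurable_funM.
by apply: measurable_funM => //; exact: measurable_funB.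
Qed.

(** The difference quotient of root densities is bounded in L_2(nu), being the QMD remainder plus
    half the score times the root density at 0. Multiplying it by [t] makes it vanish. *)
Lemma sqrt_density_L2_to0 :
  L2_to0 (0 : R)^' nu (fun t z => rp t z - rp 0 z).
Proof.
have [a sa] := Lfun2_L2le s_L2.
have sa' := L2leZ 2^-1 (L2le_density Pt0_dominated sa).
have [b qb] : L2_bounded (0 : R)^' nu (fun t z => (rp t z - rp 0 z) / t).
  apply: eq_L2_bounded (L2_boundedD (L2_to0_bounded qmd_L2_to0)
    (L2_bounded_cst (F := (0 : R)^') sa')) => t z /=.
  by rewrite mulrA subrK.
move=> e e0; have b1 : 0 < `|b| + 1 by rewrite ltr_wpDl.
have eb : 0 < e / (`|b| + 1) by rewrite divr_gt0.
near=> t.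
have t0 : t != 0 by near: t; exact: nbhs_dnbhs_neq.
have qbt : L2le nu b (fun z => (rp t z - rp 0 z) / t) by near: t.
have t1 : `|t| <= 1 by near: t; exact: dnbhs0_le.
have te : `|t| <= e / (`|b| + 1) by near: t; exact: dnbhs0_le.
have -> : (fun z => rp t z - rp 0 z) = t \*o (fun z => (rp t z - rp 0 z) / t).
  by apply/funext => z /=; rewrite mulrC divfK.
apply: L2leW (L2leZ t qbt).
apply: (@le_trans _ _ (t ^+ 2 * (`|b| + 1))).
  rewrite ler_wpM2l ?sqr_ge0//; have := ler_norm b; lra.
(* Since [|t| <= 1], [t ^+ 2] is at most [|t|]. *)
rewrite -ler_pdivlMr// (le_trans _ te)//.
by rewrite -real_normK ?num_real// expr2 ler_piMr.
Unshelve. all: by end_near.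
Qed.

(** The function [q] below is the L_1(nu) limit of [(f_t p_t - f_0 p_0) / t]. Each such quotient
    integrates to 0, because both moments vanish, so [q] integrates to 0 too. *)
Lemma score_identity (f0 : Z -> R) (g : R -> Z -> R) (D : Z -> R)
    (M C a : R) :
  measurable_fun setT f0 -> (forall z, `|f0 z| <= M) ->
  L2le (Pt 0) a D ->
  L2_to0 (0 : R)^' (Pt 0) (fun t z => g t z - D z) ->
  (\forall t \near (0 : R)^', L2le (Pt t) C (g t)) ->
  (\int[Pt 0]_z (f0 z)%:E = 0)%E ->
  (\forall t \near (0 : R)^', (\int[Pt t]_z (f0 z + t * g t z)%:E = 0)%E) ->
  \int[Pt 0]_z D z + \int[Pt 0]_z (f0 z * s z) = 0.
Proof.
move=> mf0 f0M Da gD gC Ef0 Eft.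
have [b sb] := Lfun2_L2le s_L2.
have d0 := density_ge0 Pt0_dominated.
have L2rp0 := L2le_sqrt_density Pt0_dominated.
have f0s := L2le_mul_bounded mf0 f0M sb.
have f00 := L2le_mul_bounded mf0 f0M (L2le_density Pt0_dominated sb).
have rpb : L2_bounded (0 : R)^' nu (fun t z => rp t z + rp 0 z).
  exists (2 * 1 + 2 * 1).
  apply: filterS Pt_dominated => t /L2le_sqrt_density rpt.
  exact: L2leD.
(* The moment bound under the moving measure [Pt t], rather than convergence under [Pt 0], controls
   [g t] against the moving root density. *)
have gbt : L2_bounded (0 : R)^' nu (fun t z => g t z * rp t z).
  exists C; apply: filterS2 Pt_dominated gC => t Ptnu; exact: L2le_density.
have gDnu : L2_to0 (0 : R)^' nu (fun t z => (g t z - D z) * rp 0 z).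
  move=> e /gD; apply: filterS => t gt; exact: (L2le_density Pt0_dominated gt).
have gb0 : L2_bounded (0 : R)^' nu (fun t z => g t z * rp 0 z).
  apply: eq_L2_bounded (L2_boundedD (L2_to0_bounded gDnu)
    (L2_bounded_cst (F := (0 : R)^') (L2le_density Pt0_dominated Da)))
    => t z /=.
  by rewrite mulrBl subrK.
(* w t is (f_t p_t - f_0 p_0) / t - (D + f_0 s) p_0, with f_t := f0 + t * g t,
   written as a sum of products of an L_2(nu)-vanishing factor and an
   L_2(nu)-bounded one. *)
pose w t z := (g t z - D z) * rp 0 z * rp 0 z +
  ((rp t z - rp 0 z) * (g t z * rp t z + g t z * rp 0 z) +
  (f0 z * ((rp t z - rp 0 z) / t - 2^-1 * s z * rp 0 z) * (rp t z + rp 0 z) +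
  (rp t z - rp 0 z) * (2^-1 * (f0 z * (s z * rp 0 z))))).
have w0 : L1_to0 (0 : R)^' nu w.
  apply: L1_to0D; first exact: L2_to0M gDnu (L2_bounded_cst L2rp0).
  apply: L1_to0D.
    exact: L2_to0M sqrt_density_L2_to0 (L2_boundedD gbt gb0).
  apply: L1_to0D.
    exact: L2_to0M (L2_to0_mul_bounded mf0 f0M qmd_L2_to0) rpb.
  exact: L2_to0M sqrt_density_L2_to0 (L2_bounded_cst (L2leZ 2^-1 f00)).
pose q z := D z * density nu (Pt 0) z + f0 z * s z * density nu (Pt 0) z.
have iD : nu.-integrable setT (fun z => (D z * density nu (Pt 0) z)%:E).
  by have /(integrable_density Pt0_dominated) := L2le_integrable Da.
have if0s :
    nu.-integrable setT (fun z => (f0 z * s z * density nu (Pt 0) z)%:E).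
  by have /(integrable_density Pt0_dominated) := L2le_integrable f0s.
have if0 : nu.-integrable setT (fun z => (f0 z * density nu (Pt 0) z)%:E).
  have := L2le_integrable (L2le_mul_bounded mf0 f0M (L2le_cst1 (Pt 0))).
  move=> /(integrable_density Pt0_dominated); apply: eq_integrable => // z _ /=.
  by rewrite mulr1.
have iq : nu.-integrable setT (EFin \o q).
  exact: (integrableD measurableT iD if0s).
have mD : measurable_fun setT D by case: Da.
have -> : \int[Pt 0]_z D z + \int[Pt 0]_z (f0 z * s z) = \int[nu]_z q z.
  rewrite !(Rintegral_density Pt0_dominated)// ?RintegralD//.
  by case: f0s.
have rEf0 : \int[nu]_z (f0 z * density nu (Pt 0) z) = 0.
  by rewrite -Rintegral_density// /Rintegral Ef0.
suff q0 e : 0 < e -> `|\int[nu]_z q z| <= e.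
  by apply/eqP; rewrite -normr_le0; apply/ler_addgt0Pl => e /q0; rewrite addr0.
move=> e0.
(* For a given [e], a single [t] with all the required properties suffices. *)
have [t [t0 Ptnu wt Eftt [mgt _]]] : exists t : R, [/\ t != 0, Pt t `<< nu,
    L1le nu e (w t), (\int[Pt t]_z (f0 z + t * g t z)%:E = 0)%E &
    L2le (Pt t) C (g t)].
  near (0 : R)^' => t; exists t; split; near: t => //.
  - exact: nbhs_dnbhs_neq.
  - exact: w0.
suff -> : \int[nu]_z q z = - \int[nu]_z w t z.
  by rewrite normrN; exact: L1le_Rintegral.
have dt := density_ge0 Ptnu.
have iw := L1le_integrable wt.
(* Writing each density as the square of its root turns this into a rational identity in the two
   roots. *)
have fE z : (f0 z + t * g t z) * density nu (Pt t) z =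
    f0 z * density nu (Pt 0) z + t * (w t z + q z).
  rewrite /w /q.
  have := sqr_sqrtr (dt z); have := sqr_sqrtr (d0 z).
  set x := Num.sqrt _; set y := Num.sqrt _ => <- <-.
  by field.
apply/eqP; rewrite -addr_eq0 addrC -RintegralD//.
have : t * \int[nu]_z (w t z + q z) = 0.
  have := Eftt; rewrite (integral_density Ptnu); last first.
    by apply: measurable_funD => //; exact: measurable_funM.
  under eq_integral do rewrite fE.
  move=> /(congr1 fine); rewrite -/(Rintegral nu setT _) RintegralD//.
  - by rewrite rEf0 add0r RintegralZl//; exact: (integrableD measurableT iw iq).
  - have := integrableZl measurableT t (integrableD measurableT iw iq).
    by apply: eq_integrable.
by move/eqP; rewrite mulf_eq0 (negbTE t0).
Unshelve. all: by end_near.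
Qed.

End score_identity.

(** * Chain rule in L_2(P) for the estimating function along differentiable paths *)

Section frechet_along_paths.
Context {d : measure_display} {Z : measurableType d} {R : realType}.

Lemma is_derive_quotientP (W : normedModType R) (f : R -> W) (l : W) :
  is_derive (0 : R) 1 f l <-> t^-1 *: (f t - f 0) @[t --> (0 : R)^'] --> l.
Proof.
have quotE : (fun t : R => t^-1 *: ((f \o shift 0) (t *: 1) - f 0)) =
    (fun t => t^-1 *: (f t - f 0)).
  by apply/funext => t /=; rewrite addr0 [_ *: 1]mulr1.
split=> [[df <-]|fl]; first by move: df; rewrite /derivable /derive quotE.
split; first by rewrite /derivable quotE; apply/cvg_ex; exists l.
by rewrite /derive quotE; exact: cvg_lim.
Qed.

(** Differentiability implies continuity: [f t - a] is [t] times a convergent quotient. *)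
Lemma quotient_cvg_cvg (W : normedModType R) (f : R -> W) (a l : W) :
  t^-1 *: (f t - a) @[t --> (0 : R)^'] --> l -> f t @[t --> (0 : R)^'] --> a.
Proof.
move=> fl; have t0 : t @[t --> (0 : R)^'] --> (0 : R) by exact: nbhs_dnbhs.
have : t *: (t^-1 *: (f t - a)) + a @[t --> (0 : R)^'] --> (0 : R) *: l + a.
  by apply: cvgD; [exact: cvgZ|exact: cvg_cst].
rewrite scale0r add0r; apply: cvg_trans; apply: near_eq_cvg.
near=> t; rewrite /= scalerA mulfV ?scale1r ?subrK//.
by near: t; exact: nbhs_dnbhs_neq.
Unshelve. all: by end_near.
Qed.

Variable (P : probability Z R).

(** Linearity holds only almost everywhere, and so does this; the instance [D 0 = D 0 + D 0] gives
    it. *)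
Lemma bounded_linear_L2_0 (W : normedModType R) (D : W -> Z -> R) :
  bounded_linear_L2 P D -> D 0 = cst 0 %[ae P].
Proof.
move=> [_ /(_ 1 0 0) Dlin _]; apply: filterS Dlin => z.
by rewrite scaler0 addr0 mul1r => Dz zT; have := Dz zT; rewrite /=; lra.
Qed.

(** Almost everywhere the difference is [D] applied to [t^-1 *: x t - w], whose L_2 norm is at most
    [C] times a norm tending to 0. *)
Lemma bounded_linear_quotient_L2_to0 (W : normedModType R) (D : W -> Z -> R)
    (x : R -> W) (w : W) :
  bounded_linear_L2 P D -> t^-1 *: x t @[t --> (0 : R)^'] --> w ->
  L2_to0 (0 : R)^' P (fun t z => D (x t) z / t - D w z).
Proof.
move=> bD xw e e0; have D0 := bounded_linear_L2_0 bD.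
case: bD => D2 Dlin [C DC].
have mD u : measurable_fun setT (D u).
  by have := D2 u; rewrite inE => /andP[+ _]; rewrite inE.
have Cy : (C * `|t^-1 *: x t - w|) ^+ 2 @[t --> (0 : R)^'] -->
    (C * `|w - w|) ^+ 2.
  have cy : C * `|t^-1 *: x t - w| @[t --> (0 : R)^'] --> C * `|w - w|.
    apply: cvgM; first exact: cvg_cst.
    by apply: cvg_norm; apply: cvgB => //; exact: cvg_cst.
  exact: (cvgM cy cy).
rewrite subrr normr0 mulr0 expr0n /= in Cy.
near=> t.
have t0 : t != 0 by near: t; exact: nbhs_dnbhs_neq.
have Ce : (C * `|t^-1 *: x t - w|) ^+ 2 <= e.
  by near: t; apply: (cvgr_le 0).
apply: (L2leW Ce); apply: (ae_eq_L2le _ _ (Lnorm2_le (mD _) (DC _))).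
  by apply: measurable_funB => //; exact: measurable_funM.
(* [x t] is split as [t *: (t^-1 *: x t - w) + t *: w], and [t *: w] as [t *: w + 0], to match the
   form in which linearity is stated. *)
have := Dlin t (t^-1 *: x t - w) (t *: w).
rewrite scalerBr scalerA mulfV// scale1r subrK => D1.
have := Dlin t w 0; rewrite addr0 => D2'.
apply: filterS3 D0 D1 D2' => z /(_ I) z0 /(_ I) z1 /(_ I) z2 _.
by rewrite z1 z2 z0 /=; field.
Unshelve. all: by end_near.
Qed.

Context {V : normedModType R}.

(** The remainder is o of an increment that is itself O(t). The path is arbitrary in [H], so this
    serves both the submodels and the straight lines of the Gateaux derivative. *)
Lemma frechet_quotient_L2_to0 (H : set V) (m : Z -> R -> V -> R)
    (b0 : R) (e0 : V) (Dbeta : R -> Z -> R) (Deta : V -> Z -> R)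
    (b : R -> R) (e : R -> V) (db : R) (de : V) :
  (forall b e, H e -> measurable_fun setT (fun z => m z b e)) ->
  bounded_linear_L2 P Dbeta -> bounded_linear_L2 P Deta ->
  frechet_derivative_L2 P H m b0 e0 Dbeta Deta -> H e0 ->
  (\forall t \near (0 : R)^', H (e t)) ->
  t^-1 *: (b t - b0) @[t --> (0 : R)^'] --> db ->
  t^-1 *: (e t - e0) @[t --> (0 : R)^'] --> de ->
  L2_to0 (0 : R)^' P (fun t z =>
    (m z (b t) (e t) - m z b0 e0) / t - (Dbeta db z + Deta de z)).
Proof.
move=> mm bDb bDe frechet He0 He bt et.
pose rem t z := m z (b t) (e t) - m z b0 e0 - Dbeta (b t - b0) z
                - Deta (e t - e0) z.
suff rem0 : L2_to0 (0 : R)^' P (fun t z => rem t z / t).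
  apply: eq_L2_to0 (L2_to0D rem0 (L2_to0D
    (bounded_linear_quotient_L2_to0 bDb bt)
    (bounded_linear_quotient_L2_to0 bDe et))) => t z /=.
  by rewrite /rem; ring.
have mDb u : measurable_fun setT (Dbeta u).
  by case: bDb => /(_ u) + _ _; rewrite inE => /andP[+ _]; rewrite inE.
have mDe u : measurable_fun setT (Deta u).
  by case: bDe => /(_ u) + _ _; rewrite inE => /andP[+ _]; rewrite inE.
(* [K] eventually bounds the increment divided by [|t|]. With [c = min(1, eps) / K] the norm of
   [rem t / t] is at most [min(1, eps)], and the cap at 1 keeps its square below [eps]. *)
move=> eps eps0; pose K := `|db| + 1 + (`|de| + 1).
have K0 : 0 < K by rewrite addr_gt0// ltr_wpDl.
pose c := Num.min 1 eps / K.
have c0 : 0 < c by rewrite divr_gt0// lt_min ltr01.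
have bet : (b t, e t) @[t --> (0 : R)^'] --> (b0, e0).
  exact: (cvg_pair (quotient_cvg_cvg bt) (quotient_cvg_cvg et)).
near=> t.
have t0 : t != 0 by near: t; exact: nbhs_dnbhs_neq.
have Het : H (e t) by near: t.
have mrem : measurable_fun setT (rem t).
  apply: measurable_funB => //; apply: measurable_funB => //.
  by apply: measurable_funB; exact: mm.
have dbt : `|t^-1 *: (b t - b0)| <= `|db| + 1.
  near: t; apply: (cvgr_le `|db|); last by rewrite ltrDl.
  exact: cvg_norm bt.
have det : `|t^-1 *: (e t - e0)| <= `|de| + 1.
  near: t; apply: (cvgr_le `|de|); last by rewrite ltrDl.
  exact: cvg_norm et.
have remt : ('N[P]_2%:E[EFin \o rem t] <=
    (c * (`|b t - b0| + `|e t - e0|))%:E)%E.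
  move: Het; near: t; apply: (bet _ (frechet c c0)).
have -> : (fun z => rem t z / t) = t^-1 \*o rem t.
  by apply/funext => z /=; rewrite mulrC.
apply: L2leW (L2leZ t^-1 (Lnorm2_le mrem remt)).
rewrite -exprMn mulrCA.
rewrite -real_normK ?num_real// normrM (gtr0_norm c0) normrM.
rewrite [`|_ + _|]ger0_norm; last by rewrite addr_ge0.
have ctK : c * (`|t^-1| * (`|b t - b0| + `|e t - e0|)) <= Num.min 1 eps.
  rewrite /c -mulrA ler_piMr//; first by rewrite le_min ler01 ltW.
  rewrite ler_pdivrMl// mulr1 mulrDr.
  by rewrite -[in leLHS]normrM -normrZ lerD.
apply: (le_trans (y := Num.min 1 eps)); last by rewrite ge_min lexx orbT.
rewrite expr2 (le_trans _ ctK)// ler_piMr//.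
  by apply: mulr_ge0; [exact: ltW|rewrite mulr_ge0 ?addr_ge0].
by rewrite (le_trans ctK)// ge_min lexx.
Unshelve. all: by end_near.
Qed.

End frechet_along_paths.

(** * The moment identity along a coordinate submodel *)

Section coordinate_submodels.
Context {R : realType} {d : measure_display} {Z : measurableType d}.
Variables (nu : {sigma_finite_measure set Z -> \bar R}).
Variables (model : set (probability Z R)).
Hypothesis model_dominated : forall P : probability Z R, model P -> P `<< nu.
Context {V : normedModType R}.
Variables (H : set V).
Variables (beta : probability Z R -> R) (eta : probability Z R -> V).
Hypothesis eta_H : forall P : probability Z R, model P -> H (eta P).
Variables (m : Z -> R -> V -> R).
Hypothesis m_measurable : forall (b : R) (e : V), H e ->
  measurable_fun setT (fun z => m z b e).
Variables (Dbeta : R -> Z -> R) (Deta : V -> Z -> R).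

Lemma coordinate_submodel_moment (P0 : probability Z R) (eps : R)
    (Pt : R -> probability Z R) (s : Z -> R) (db : R) (de : V) :
  model P0 -> correctly_specified model beta eta m P0 ->
  bounded_linear_L2 P0 Dbeta -> bounded_linear_L2 P0 Deta ->
  frechet_derivative_L2 P0 H m (beta P0) (eta P0) Dbeta Deta ->
  pathwise_differentiable nu model beta P0
    (fun z => m z (beta P0) (eta P0)) ->
  coordinate_submodel nu model beta eta P0 eps Pt s db de ->
  regular_along beta eta m P0 eps Pt s ->
  \int[P0]_z (Dbeta db z + Deta de z) + db = 0.
Proof.
move=> P0m [U nU Um] bDb bDe frechet [[f02 Ef0] pathwise] [reg bd ed].
(* [beta \o Pt] has derivative [db] by the coordinate property and the score integral by pathwise
   differentiability; the two agree by uniqueness. *)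
have db_score : db = \int[P0]_z (m z (beta P0) (eta P0) * s z).
  rewrite -(@derive_val _ _ _ _ _ _ _ bd).
  by rewrite (@derive_val _ _ _ _ _ _ _ (pathwise _ _ _ reg)).
case: reg => eps0 Ptm Pt0 [s2 _] qmd.
move=> [_ _ [M [_ Mf0]] _ [delta [C [/andP[delta0 _] gC]]]].
have H0 := eta_H P0m.
move/is_derive_quotientP : bd => bt; move/is_derive_quotientP : ed => et.
subst P0; rewrite [X in _ + X]db_score.
have [a Dba] : exists a, L2le (Pt 0) a (Dbeta db).
  by apply: Lfun2_L2le; case: bDb.
have [b Deb] : exists b, L2le (Pt 0) b (Deta de).
  by apply: Lfun2_L2le; case: bDe.
have Pt_model : \forall t \near (0 : R)^', model (Pt t).
  by apply: filterS (dnbhs0_lt eps0) => t; exact: Ptm.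
have mf t : model (Pt t) ->
    measurable_fun setT (fun z => m z (beta (Pt t)) (eta (Pt t))).
  by move=> /eta_H; exact: m_measurable.
have mg t : model (Pt t) -> measurable_fun setT (fun z =>
    (m z (beta (Pt t)) (eta (Pt t)) - m z (beta (Pt 0)) (eta (Pt 0))) / t).
  move=> Ptmt; apply: measurable_funM => //.
  by apply: measurable_funB; exact: mf.
pose f0 z := m z (beta (Pt 0)) (eta (Pt 0)).
pose g t z := (m z (beta (Pt t)) (eta (Pt t)) - f0 z) / t.
pose D z := Dbeta db z + Deta de z.
have DL2 : L2le (Pt 0) (2 * a + 2 * b) D by exact: L2leD Dba Deb.
rewrite -/f0 in Mf0 mg Ef0.
apply: (score_identity (nu := nu) (g := g) (M := `|M| + 1) (C := C)
  _ _ s2 qmd _ _ DL2).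
- exact: model_dominated.
- by apply: filterS Pt_model => t; exact: model_dominated.
- exact: mf.
(* Boundedness gives every real above [M] as a bound, in particular [|M| + 1]. *)
- by move=> z; apply: Mf0 => //; rewrite (le_lt_trans (ler_norm M))// ltrDl.
- apply: (frechet_quotient_L2_to0 m_measurable bDb bDe frechet H0 _ bt et).
  by apply: filterS Pt_model => t; exact: eta_H.
- near=> t.
  have Ptmt : model (Pt t) by near: t.
  split; first exact: (mg t Ptmt).
  have : 0 < `|t| < delta.
    rewrite normr_gt0; apply/andP; split; near: t; last exact: dnbhs0_lt.
    exact: nbhs_dnbhs_neq.
  by move=> /gC; rewrite unlock.
- by move: Ef0; rewrite unlock.
(* The path is continuous at 0, so it eventually stays in the neighborhood where correct
   specification applies. *)
- have Ut : \forall t \near (0 : R)^', U (beta (Pt t), eta (Pt t)).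
    exact: (cvg_pair (quotient_cvg_cvg bt) (quotient_cvg_cvg et) nU).
  near=> t.
  have t0 : t != 0 by near: t; exact: nbhs_dnbhs_neq.
  have Ptmt : model (Pt t) by near: t.
  have Utt : U (beta (Pt t), eta (Pt t)) by near: t.
  have := Um _ Ptmt Utt; rewrite unlock => <-.
  by apply: eq_integral => z _; rewrite /g mulrC divfK// addrC subrK.
Unshelve. all: by end_near.
Qed.

End coordinate_submodels.

(** * Orthogonality along straight lines, and the normalization *)

Unset Implicit Arguments.

Theorem theorem2 (R : realType) (d : measure_display) (Z : measurableType d)
    (nu : {sigma_finite_measure set Z -> \bar R})
    (model : set (probability Z R))
    (model_dominated : forall P : probability Z R, model P -> P `<< nu)
    (P0 : probability Z R) (P0_model : model P0)
    (V : normedModType R) (H : set V)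
    (beta : probability Z R -> R) (eta : probability Z R -> V)
    (eta_H : forall P : probability Z R, model P -> H (eta P))
    (m : Z -> R -> V -> R)
    (m_measurable : forall (b : R) (e : V), H e ->
       measurable_fun setT (fun z => m z b e))
    (correct_specification : correctly_specified model beta eta m P0)
    (Dbeta : R -> Z -> R) (Deta : V -> Z -> R)
    (Dbeta_bounded_linear : bounded_linear_L2 P0 Dbeta)
    (Deta_bounded_linear : bounded_linear_L2 P0 Deta)
    (frechet_differentiable :
       frechet_derivative_L2 P0 H m (beta P0) (eta P0) Dbeta Deta)
    (influence_function :
       pathwise_differentiable nu model beta P0
         (fun z => m z (beta P0) (eta P0)))
    (eps_beta : R) (Pt_beta : R -> probability Z R) (s_beta : Z -> R)
    (beta_coordinate :
       coordinate_submodel nu model beta eta P0 eps_beta Pt_beta s_beta 1 0)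
    (eps_eta : V -> R) (Pt_eta : V -> R -> probability Z R)
    (s_eta : V -> Z -> R)
    (eta_coordinate : forall h : V, admissible_directions H (eta P0) h ->
       coordinate_submodel nu model beta eta P0
         (eps_eta h) (Pt_eta h) (s_eta h) 0 h)
    (beta_regularity :
       regular_along beta eta m P0 eps_beta Pt_beta s_beta)
    (eta_regularity : forall h : V, admissible_directions H (eta P0) h ->
       regular_along beta eta m P0 (eps_eta h) (Pt_eta h) (s_eta h)) :
  (forall h : V, admissible_directions H (eta P0) h ->
     is_gateaux_derivative P0 (fun z e => m z (beta P0) e) (eta P0) h 0) /\
  ('E_P0[Dbeta 1%R] = (-1)%:E)%E.
Proof.
have moment := fun eps Pt s db de => coordinate_submodel_moment
  model_dominated eta_H m_measurable (eps := eps) (Pt := Pt) (s := s)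
  (db := db) (de := de) P0_model correct_specification Dbeta_bounded_linear
  Deta_bounded_linear frechet_differentiable influence_function.
have iDb b : P0.-integrable setT (EFin \o Dbeta b).
  have [a Da] : exists a, L2le P0 a (Dbeta b).
    by apply: Lfun2_L2le; case: Dbeta_bounded_linear.
  exact: L2le_integrable Da.
split.
- move=> h hadm.
  have H0 := eta_H _ P0_model.
  have mean0 := moment _ _ _ _ _ (eta_coordinate h hadm)
    (eta_regularity h hadm).
  have [a Da] : exists a, L2le P0 a (fun z => Dbeta 0 z + Deta h z).
    have [a0 Dba] : exists a, L2le P0 a (Dbeta 0).
      by apply: Lfun2_L2le; case: Dbeta_bounded_linear.
    have [b Deb] : exists b, L2le P0 b (Deta h).
      by apply: Lfun2_L2le; case: Deta_bounded_linear.
    by eexists; exact: (L2leD Dba Deb).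
  have iD := L2le_integrable Da.
  have if0 : P0.-integrable setT (EFin \o (fun z => m z (beta P0) (eta P0))).
    case: influence_function => -[/Lfun2_L2le[c f0c] _] _.
    exact: L2le_integrable f0c.
  (* The line [eta P0 + t *: h] with [beta] frozen need not come from a submodel, but it has the
     same velocity [(0, h)] as the eta-coordinate submodel. The limit is kept as [Dbeta 0 + Deta h]
     so that [mean0] applies verbatim. *)
  set F := fun z e => m z (beta P0) e.
  pose g t z := (F z (eta P0 + t *: h) - F z (eta P0)) / t.
  have g0 : L2_to0 (0 : R)^' P0
      (fun t z => g t z - (Dbeta 0 z + Deta h z)).
    apply: (frechet_quotient_L2_to0 (b := fun=> beta P0)
      (e := fun t => eta P0 + t *: h) m_measurable Dbeta_bounded_linear
      Deta_bounded_linear frechet_differentiable H0).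
    + have [eps eps0 Heps] := hadm.
      by apply: filterS (dnbhs0_lt eps0) => t; exact: Heps.
    + under eq_fun do rewrite subrr scaler0.
      exact: cvg_cst.
    + have : h @[t --> (0 : R)^'] --> h by exact: cvg_cst.
      apply: cvg_trans; apply: near_eq_cvg; near=> t.
      rewrite /= [eta P0 + _]addrC addrK scalerA mulVf ?scale1r//.
      by near: t; exact: nbhs_dnbhs_neq.
  have ig t e : L2le P0 e (fun z => g t z - (Dbeta 0 z + Deta h z)) ->
      P0.-integrable setT (fun z => (g t z)%:E).
    move=> /L2le_integrable gD.
    have := integrableD measurableT gD iD.
    by apply: eq_integrable => // z _; rewrite /= -EFinD subrK.
  have iF : \forall t \near (0 : R)^',
      P0.-integrable setT (fun z => (F z (eta P0 + t *: h))%:E).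
    near=> t.
    have t0 : t != 0 by near: t; exact: nbhs_dnbhs_neq.
    have gDt : L2le P0 1 (fun z => g t z - (Dbeta 0 z + Deta h z)).
      by near: t; exact: g0.
    have := integrableD measurableT if0
      (integrableZl measurableT t (ig _ _ gDt)).
    apply: eq_integrable => // z _.
    by rewrite /= -EFinM -EFinD /g mulrC divfK// addrC subrK.
  split.
    (* A full neighborhood of 0 is a punctured one together with the point 0, where integrability is
       that of [f_0]. *)
    suff : ((0 : R)^' `&` principal_filter (0 : R)) [set t |
        P0.-integrable setT (fun z => (F z (eta P0 + t *: h))%:E)].
      by rewrite -dnbhsE.
    by split=> //; apply/principal_filterP; rewrite /= scale0r addr0.
  apply/is_derive_quotientP/cvgrPdist_le => e e0; near=> t.
  have t0 : t != 0 by near: t; exact: nbhs_dnbhs_neq.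
  (* The factor 1, square integrable under a probability, turns L_2 convergence into L_1
     convergence. *)
  have gDt : L1le P0 e (fun z => (g t z - (Dbeta 0 z + Deta h z)) * 1).
    near: t; apply: (L2_to0M g0 (L2_bounded_cst (L2le_cst1 P0))) => //.
  have iFt : P0.-integrable setT (fun z => (F z (eta P0 + t *: h))%:E).
    by near: t.
  suff -> : t^-1 *: (\int[P0]_z F z (eta P0 + t *: h) -
      \int[P0]_z F z (eta P0 + 0 *: h)) =
      \int[P0]_z ((g t z - (Dbeta 0 z + Deta h z)) * 1).
    by rewrite sub0r normrN; exact: L1le_Rintegral.
  transitivity (t^-1 * (\int[P0]_z F z (eta P0 + t *: h) -
      \int[P0]_z F z (eta P0))); first by rewrite scale0r addr0.
  rewrite -RintegralB// -RintegralZl//.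
    transitivity (\int[P0]_z ((g t z - (Dbeta 0 z + Deta h z)) * 1 +
        (Dbeta 0 z + Deta h z))).
      by apply: eq_Rintegral => z _; rewrite mulr1 subrK /g mulrC.
    rewrite RintegralD//; last exact: L1le_integrable gDt.
    by move: mean0; rewrite addr0 => ->; rewrite addr0.
  by have := integrableB measurableT iFt if0; apply: eq_integrable.
- have := moment _ _ _ _ _ beta_coordinate beta_regularity.
  have D0 := bounded_linear_L2_0 Deta_bounded_linear.
  (* [Deta 0] is zero only almost everywhere, so the two sides are compared as integrals. *)
  have <- : \int[P0]_z Dbeta 1 z = \int[P0]_z (Dbeta 1 z + Deta 0 z).
    have mDb : measurable_fun setT (Dbeta 1).
      by apply/measurable_EFinP; exact: measurable_int (iDb 1).
    have mDe : measurable_fun setT (Deta 0).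
      case: Deta_bounded_linear => /(_ 0) + _ _.
      by rewrite inE => /andP[+ _]; rewrite inE.
    congr fine; apply: ae_eq_integral => //.
    + exact/measurable_EFinP.
    + by apply/measurable_EFinP; exact: measurable_funD.
    + by apply: filterS D0 => z Dz zT; rewrite (Dz zT) addr0.
  move/eqP; rewrite addr_eq0 => /eqP ED.
  (* The real integral is the [fine] part of the expectation; integrability makes the latter finite,
     which lifts the equality to the extended reals. *)
  by rewrite unlock -[RHS](congr1 EFin ED) fineK//;
    exact: integrable_fin_num (iDb 1).
Unshelve. all: by end_near.
Qed.
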